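(* Let $\mathcal{G}_d^+=(\mathcal{N}_d^+,\mathcal{A}_d^+)$ be the directed graph for driver $d\in\mathcal{O}^+=\{1,\dots,n\}$, with travel times $\tau_{(i,j)}\ge 0$ satisfying the triangle inequality, service durations $s_i\ge 0$, time windows $[a_i,b_i]$, demands $\kappa_i\ge 0$, ride-duration limits $L_i$, vehicle capacity $K$, and real edge costs $c_{(i,j)}$ (possibly negative). If $$L_i<2\tau_{(i,n+i)}+s_i\qquad\text{for each } i\in\mathcal{O}^+,$$ then no non-elementary path is generated by the resource-constrained shortest path algorithm (RCSPA) on $\mathcal{G}_d^+$; that is, every path from $d$ to $n+d$ generated by the RCSPA visits each node of $\mathcal{N}_d^+$ at most once.
   Context: **Graph.** Let $n\ge 1$ be the number of riders, $\mathcal{O}^+=\{1,\dots,n\}$ the set of pickup (origin) nodes and $\mathcal{D}^+=\{n+1,\dots,2n\}$ the set of drop-off (destination) nodes. Node $i\in\mathcal{O}^+$ is the origin of rider $i$ and $n+i$ is her destination. Fix a driver $d\in\mathcal{O}^+$. The graph $\mathcal{G}_d^+$ has node set $\mathcal{N}_d^+=\mathcal{O}^+\cup\mathcal{D}^+$ and a set $\mathcal{A}_d^+$ of directed edges between distinct nodes (the complete set of edges, from which some edges may have been removed in preprocessing). Each node $i\in\mathcal{N}_d^+$ has a time window $[a_i,b_i]$ and a service duration $s_i\ge 0$. Each $i\in\mathcal{O}^+$ has a ride-duration limit $L_i$ and a demand $\kappa_i\ge 0$. Each edge has a cost $c_{(i,j)}\in\mathbb{R}$. Travel times $\tau_{(i,j)}\ge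 0$ are defined for all pairs of nodes and satisfy the triangle inequality. $K$ is the vehicle capacity. **Labels.** A path (walk in $\mathcal{G}_d^+$, nodes may a priori be repeated) $\mathcal{P}$ from $d$ to a node $l$ carries a label $(c,T,\mathcal{C},\mathcal{R},\mathcal{W})$. Here $c$ is the total edge cost and $T$ is the service start time at $l$. $\mathcal{C}\subseteq\mathcal{O}^+$ is the set of riders on board after visiting $l$, and $\mathcal{R}\subseteq\mathcal{O}^+$ is the set of all riders picked up so far. $\mathcal{W}=\{w(m):m\in\mathcal{R}\}$ collects, for each rider $m\in\mathcal{R}$, the accumulated trip duration excluding wait times, i.e. the sum of $s_i+\tau_{(i,j)}$ over all edges $(i,j)$ of $\mathcal{P}$ (counted with multiplicity) traversed while $m$ is on board. **Initialization.** The trivial path at $d$ has label $c=0$, $T=a_d$, $\mathcal{C}=\{d\}$, $\mathcal{R}=\{d\}$, $w(d)=0$. **Extension.** A path ending at $l$ with label $(c,T,\mathcal{C},\mathcal{R},\mathcal{W})$ is extended along an edge $(l,j)\in\mathcal{A}_d^+$ to a path with label $(c',T',\mathcal{C}',\mathcal{R}',\mathcal{W}')$ given by: - $c'=c+c_{(l,j)}$. - $T'=\max\{a_j,\,T+s_l+\tau_{(l,j)}\}$ if $j\in\mathcal{O}^+$, and $T'=T+s_l+\tau_{(l,j)}$ otherwise. - $\mathcal{C}'=\mathcal{C}\cup\{j\}$ if $j\in\mathcal{O}^+$, and $\mathcal{C}'=\mathcal{C}\setminus\{j-n\}$ otherwise. - $\mathcal{R}'=\mathcal{R}\cup\{j\}$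 if $j\in\mathcal{O}^+$, and $\mathcal{R}'=\mathcal{R}$ otherwise. - $w'(j)=0$ if $j\in\mathcal{O}^+$ and $j\notin\mathcal{R}$; $w'(i)=w(i)+s_l+\tau_{(l,j)}$ for all $i\in\mathcal{C}$; and $w'(i)=w(i)$ for all $i\in\mathcal{R}\setminus\mathcal{C}$. In particular, $w(i)$ is not reset if rider $i$ is picked up again. The extension is performed only if all of the following hold: - $T'\le b_j$. - $j\notin\mathcal{C}$ if $j\in\mathcal{O}^+$. - $j-n\in\mathcal{C}$ if $j\in\mathcal{D}^+$. - $\sum_{i\in\mathcal{C}'}\kappa_i\le K$. - $w'(i)-s_i\le L_i$ for all $i\in\mathcal{C}$. **Generated paths.** A path from $d$ to $n+d$ is *generated by the RCSPA* if it is obtained from the trivial path at $d$ by a finite sequence of such extensions and its final label has $\mathcal{C}=\emptyset$. (The algorithm outputs a minimum-cost path among such paths; any additional pruning of labels it performs only removes paths.) A path is *elementary* if it visits each node at most once, and *non-elementary* otherwise. *)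

(* Defs.v *)
From HB Require Import structures.
From mathcomp Require Export all_boot all_order all_algebra.
Export Order.TTheory GRing.Theory Num.Theory.

Set Implicit Arguments.
Unset Strict Implicit.
Unset Printing Implicit Defensive.

Local Open Scope ring_scope.

(* Riders are indexed by 'I_n; [inl i] is the origin (pickup node) of rider i
   and [inr i] is her destination (the node written n + i). *)
Definition node (n : nat) : finType := ('I_n + 'I_n)%type.

(* Edge costs are total functions, but only their values on edges are used. *)
Record instance (R : realFieldType) (n : nat) := Instance {
  driver : 'I_n;
  edge : rel (node n);
  cost : node n -> node n -> R;
  tau : node n -> node n -> R;
  service : node n -> R;
  tw_start : node n -> R;
  tw_end : node n -> R;
  ride_limit : 'I_n -> R;
  demand : 'I_n -> R;
  capacity : R
}.

(* The family {w(m) : m in R} is a total function whose values outside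
   [lab_picked] are meaningless and are never read. *)
Record label (R : realFieldType) (n : nat) := Label {
  lab_cost : R;
  lab_time : R;
  lab_onboard : {set 'I_n};
  lab_picked : {set 'I_n};
  lab_trip : 'I_n -> R
}.

Section RCSPA.
Variables (R : realFieldType) (n : nat) (I : instance R n).
Implicit Types (l j : node n) (lab : label R n) (P : seq (node n)).

Definition init_label : label R n :=
  {| lab_cost := 0;
     lab_time := tw_start I (inl (driver I));
     lab_onboard := [set driver I];
     lab_picked := [set driver I];
     lab_trip := fun _ => 0 |}.

Definition ext_time l j lab : R :=
  let t := lab_time lab + service I l + tau I l j in
  match j with
  | inl _ => Num.max (tw_start I j) t
  | inr _ => t
  end.

Definition ext_onboard j lab : {set 'I_n} :=
  match j with
  | inl i => i |: lab_onboard lab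
  | inr i => lab_onboard lab :\ i
  end.

Definition ext_picked j lab : {set 'I_n} :=
  match j with
  | inl i => i |: lab_picked lab
  | inr _ => lab_picked lab
  end.

Definition ext_trip l j lab (i : 'I_n) : R :=
  if (j == inl i) && (i \notin lab_picked lab) then 0
  else if i \in lab_onboard lab then
    lab_trip lab i + service I l + tau I l j
  else lab_trip lab i.

Definition extend l j lab : label R n :=
  {| lab_cost := lab_cost lab + cost I l j;
     lab_time := ext_time l j lab;
     lab_onboard := ext_onboard j lab;
     lab_picked := ext_picked j lab;
     lab_trip := ext_trip l j lab |}.

(* The ride-duration test ranges over the riders on board before the
   extension, so that it also covers the rider dropped off at [j]. *)
Definition extension_feasible l j lab : Prop :=
  [/\ ext_time l j lab <= tw_end I j,
      match j with
      | inl i => i \notin lab_onboard lab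
      | inr i => i \in lab_onboard lab
      end,
      \sum_(i in ext_onboard j lab) demand I i <= capacity I
    & forall i, i \in lab_onboard lab ->
        ext_trip l j lab i - service I (inl i) <= ride_limit I i].

(* Paths are listed in order of visit, endpoints included. *)
Inductive labelled_path : seq (node n) -> label R n -> Prop :=
| labelled_init : labelled_path [:: inl (driver I)] init_label
| labelled_extend P l j lab :
    labelled_path (rcons P l) lab ->
    edge I l j ->
    extension_feasible l j lab ->
    labelled_path (rcons (rcons P l) j) (extend l j lab).

Definition generated P : Prop :=
  (exists P', P = rcons P' (inr (driver I))) /\
  (exists2 lab, labelled_path P lab & lab_onboard lab = set0).

End RCSPA.

Definition elementary (n : nat) (P : seq (node n)) : bool := uniq P.

(* Main.v *)
Require Import Defs.
From mathcomp Require Import lra.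
Local Open Scope ring_scope.

(** The trip duration [w i] is never reset, so every completed ride of rider
    [i] adds at least [s_i + tau (i, n+i)] to it, by the triangle inequality.
    At the second drop-off of [i] it would be at least
    [2 * (s_i + tau (i, n+i)) > L_i + s_i], which the ride-duration test
    forbids. So every destination is visited at most once, and since the
    vehicle ends empty, each origin is visited as often as its destination. *)

(** Feasibility allows a pickup of [i] only off board and a drop-off only on board, so the two kinds
    of visit alternate, starting with a pickup. *)
Lemma labelled_path_count {R : realFieldType} {n : nat} {I : instance R n}
  {P : seq (node n)} {lab : label R n} (i : 'I_n) :
  labelled_path I P lab ->
  count_mem (inl i) P = (count_mem (inr i) P + (i \in lab_onboard lab))%N.
Proof.
elim=> [|{}P l j {}lab _ IH _ [_ onb _ _]] /=.
  by rewrite !inE (inj_eq inl_inj) eq_sym; case: eqP.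
rewrite -(cats1 _ j) !count_cat /= IH.
case: j onb => k onb /=; rewrite !inE !(inj_eq inl_inj, inj_eq inr_inj) /=;
  rewrite (eq_sym i); have [<-|_] := eqVneq k i; rewrite ?onb ?(negPf onb) /=;
  by rewrite ?addn0 ?addn1.
Qed.

Lemma labelled_path_picked {R : realFieldType} {n : nat} {I : instance R n}
  {P : seq (node n)} {lab : label R n} (i : 'I_n) :
  labelled_path I P lab -> inl i \in P -> i \in lab_picked lab.
Proof.
elim=> [|{}P l j {}lab _ IH _ _] /=; first by rewrite !inE (inj_eq inl_inj).
rewrite mem_rcons inE => /orP[/eqP <-|/IH]; first by rewrite /= setU11.
by case: j => k //= ki; rewrite inE ki orbT.
Qed.

Definition direct_ride {R : realFieldType} {n : nat} (I : instance R n)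
  (i : 'I_n) : R := service I (inl i) + tau I (inl i) (inr i).

(* Zero at the origin itself, where the service has not been counted yet;
   [tau] need not vanish on the diagonal. *)
Definition ride_bound {R : realFieldType} {n : nat} (I : instance R n)
  (i : 'I_n) (l : node n) : R :=
  if l == inl i then 0 else service I (inl i) + tau I (inl i) l.

(** Triangle inequality through [l], dropping the service at [l]; when [l] is the origin of [i],
    both sides agree. *)
Lemma ride_bound_extend {R : realFieldType} {n : nat} {I : instance R n}
  (tau_triangle : forall i j k : node n, tau I i k <= tau I i j + tau I j k)
  (service_ge0 : forall i : node n, 0 <= service I i)
  (i : 'I_n) (l j : node n) :
  service I (inl i) + tau I (inl i) j
    <= ride_bound I i l + service I l + tau I l j.
Proof.
rewrite /ride_bound; case: eqP => [->|_]; first by rewrite add0r.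
by have := tau_triangle (inl i) l j; have := service_ge0 l; lra.
Qed.

(** Each completed ride of [i] contributes [direct_ride], and a ride in progress contributes
    [ride_bound] at the current node. *)
Lemma labelled_path_trip {R : realFieldType} {n : nat} {I : instance R n}
  (tau_triangle : forall i j k : node n, tau I i k <= tau I i j + tau I j k)
  (service_ge0 : forall i : node n, 0 <= service I i)
  {P : seq (node n)} {lab : label R n} (i : 'I_n) :
  labelled_path I P lab ->
  (count_mem (inr i) P)%:R * direct_ride I i
    + (if i \in lab_onboard lab
       then ride_bound I i (last (inl (driver I)) P) else 0)
    <= lab_trip lab i.
Proof.
elim=> [|{}P l j {}lab lP IH _ [_ onb _ _]] /=.
  rewrite !inE /ride_bound (inj_eq inl_inj) eq_sym.
  by case: eqP => _; rewrite mul0r add0r.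
have cnt := labelled_path_count i lP; have pick := labelled_path_picked i lP.
have step := ride_bound_extend tau_triangle service_ge0 i l j.
move: IH cnt pick; rewrite !last_rcons -(cats1 _ j) count_cat /=.
set c := count_mem (inr i) (rcons P l); move=> IH cnt pick.
rewrite /ext_trip addn0 natrD.
case: j onb step => k /= onb step; rewrite !inE !(inj_eq inl_inj, inj_eq inr_inj) /=;
  rewrite (eq_sym i); have [eki|neki] := eqVneq k i => /=.
- rewrite -eki (negPf onb) in IH cnt *; rewrite {1}/ride_bound eqxx.
  (* The trip is set to 0 only at a first pickup. Drop-offs equal pickups while [i] is off board, so
     none has occurred by then. *)
  rewrite addr0 addr0; case: ifPn => [npick|_]; last by move: IH; rewrite addr0.
  suff -> : c = 0%N by rewrite mul0r.
  apply/eqP; rewrite -leqn0 leqNgt; apply/negP => c_gt0.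
  case/negP: npick; rewrite eki; apply: pick.
  by rewrite -has_pred1 has_count -eki cnt addn0.
- rewrite addr0; case: ifP IH => // _ IH.
  by rewrite {1}/ride_bound (inj_eq inl_inj) (negPf neki); lra.
(* At the drop-off of [i], [step] turns the ride in progress into one more [direct_ride]. *)
- by rewrite -eki onb in IH step *; move: IH step; rewrite /direct_ride; lra.
- rewrite addr0; case: ifP IH => // _ IH.
  by rewrite {1}/ride_bound /=; lra.
Qed.

Lemma labelled_path_dropoff_le1 {R : realFieldType} {n : nat}
  {I : instance R n}
  (tau_ge0 : forall i j : node n, 0 <= tau I i j)
  (tau_triangle : forall i j k : node n, tau I i k <= tau I i j + tau I j k)
  (service_ge0 : forall i : node n, 0 <= service I i)
  (ride_limit_lt : forall i : 'I_n,
     ride_limit I i < 2 * tau I (inl i) (inr i) + service I (inl i))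
  {P : seq (node n)} {lab : label R n} (i : 'I_n) :
  labelled_path I P lab -> (count_mem (inr i) P <= 1)%N.
Proof.
elim=> [|{}P l j {}lab lP IH ed feas] //.
(* The bound is taken after the extension, so that it counts the ride ending at [j]. *)
have := labelled_path_trip tau_triangle service_ge0 i (labelled_extend lP ed feas).
have [_ onb _ /(_ i) lim] := feas.
rewrite -(cats1 _ j) count_cat /= addn0.
have [ej|_] := eqVneq j (inr i); last by rewrite addn0.
move: onb lim; rewrite ej /= => onb /(_ onb) lim.
rewrite setD11 addr0 addn1 ltnS leqn0 => trip.
have [//|c_neq0] := eqVneq (count_mem (inr i) (rcons P l)) 0%N.
have dr_ge0 : 0 <= direct_ride I i by rewrite addr_ge0.
have : 2 * direct_ride I i
       <= (count_mem (inr i) (rcons P l)).+1%:R * direct_ride I i.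
  by rewrite ler_wpM2r // ler_nat ltnS lt0n.
by have := ride_limit_lt i; move: trip lim; rewrite /direct_ride; lra.
Qed.

Theorem proposition1 (R : realFieldType) (n : nat) (I : instance R n)
  (hn : (1 <= n)%N)
  (edge_distinct : forall i j : node n, edge I i j -> i != j)
  (tau_ge0 : forall i j : node n, 0 <= tau I i j)
  (tau_triangle : forall i j k : node n, tau I i k <= tau I i j + tau I j k)
  (service_ge0 : forall i : node n, 0 <= service I i)
  (demand_ge0 : forall i : 'I_n, 0 <= demand I i)
  (ride_limit_lt : forall i : 'I_n,
     ride_limit I i < 2 * tau I (inl i) (inr i) + service I (inl i)) :
  forall P : seq (node n), generated I P -> elementary P.
Proof.
move=> P [_ [lab lP onb0]]; apply: count_mem_uniq => x.
suff: (count_mem x P <= 1)%N by rewrite -has_pred1 has_count; case: count => [|[]].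
have drop i : (count_mem (inr i) P <= 1)%N.
  exact: labelled_path_dropoff_le1 lP.
case: x => i; last exact: drop.
by rewrite (labelled_path_count i lP) onb0 inE addn0 drop.
Qed.
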